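(* Let $G$ be a subgroup of $U$ of odd (finite) index that is generated by rotations. Then $G$ contains a member of each of the nine conjugacy classes of rotations in $U$; that is, for each $g\in\{a,a^2,a^3,b,b^2,b^3,c,c^2,c^3\}$, $G$ contains an element conjugate to $g$ in $U$.
   Context: The group $U$. Let $\tau=(1+\sqrt5)/2$. Use the Klein model of hyperbolic 3-space $H^3$ given by the open ball of radius $R=\tau^{3/2}$ centred at the origin of $\mathbb R^3$. Let $D_0$ be the regular dodecahedron with vertices $(\pm1,\pm1,\pm1)$, $(\pm\tau^{-1},0,\pm\tau)$, $(\pm\tau,\pm\tau^{-1},0)$, $(0,\pm\tau,\pm\tau^{-1})$; for this $R$ it is a regular hyperbolic dodecahedron all of whose dihedral angles are $90^\circ$. $U$ is the discrete group of orientation-preserving isometries of $H^3$ generated by the $90^\circ$ hyperbolic rotations $a,b,c$ about the lines $\{(t,0,\tau)\}$, $\{(\tau,t,0)\}$, $\{(0,\tau,t)\}$ respectively (each contains an edge of $D_0$). $U$ is the orbifold group of the hyperbolic orbifold with underlying space $S^3$ and singular set the Borromean rings with singular angle $90^\circ$; $D_0$ is a fundamental domain for $U$. With suitable choices of the senses of rotation and with $\overline g=g^{-1}$, $$U=\langle a,b,c\mid a\,b\overline c\overline b c=b\overline c\overline b c\,a,\ b\,c\overline a\overline c a=c\overline a\overline c a\,b,\ c\,a\overline b\overline a b=a\overline b\overline a b\,c,\ a^4,\ b^4,\ c^4\rangle.$$ A rotation in $U$ is a non-identity element of $U$ that fixes some hyperbolic line (its axis) pointwise. The rotations in $U$ form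 exactly nine conjugacy classes in $U$, represented by $a,a^2,a^3,b,b^2,b^3,c,c^2,c^3$. A subgroup is generated by rotations if it is generated by the rotations of $U$ that it contains. *)

(* Defs.v *)
From HB Require Import structures.
From mathcomp Require Import all_boot all_order all_algebra.
From mathcomp Require Import all_classical all_reals all_analysis.

Set Implicit Arguments.
Unset Strict Implicit.
Unset Printing Implicit Defensive.

Import Order.TTheory GRing.Theory Num.Theory.

Local Open Scope classical_set_scope.
Local Open Scope ring_scope.

Section KleinModel.
Variable R : realType.

Definition golden : R := (1 + Num.sqrt 5) / 2.

Definition kradius : R := golden `^ (3 / 2).

(* The library norm on ['rV_3] is the sup norm, hence this inner product. *)
Definition dot (u v : 'rV[R]_3) : R := \sum_i u 0 i * v 0 i.

Definition vec3 (x y z : R) : 'rV[R]_3 := \row_i [:: x; y; z]`_i.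

Record klein := Klein {
  kpt :> 'rV[R]_3;
  kptP : dot kpt kpt < kradius ^+ 2 }.

HB.instance Definition _ := [isSub for kpt].
HB.instance Definition _ := [Choice of klein by <:].

Definition acosh (u : R) : R := ln (u + Num.sqrt (u ^+ 2 - 1)).

Definition hdist (x y : klein) : R :=
  acosh ((kradius ^+ 2 - dot x y) /
         Num.sqrt ((kradius ^+ 2 - dot x x) * (kradius ^+ 2 - dot y y))).

(* The Riemannian metric of the Klein model, of curvature -1, at the point p;
   it is not conformal to the Euclidean one. *)
Definition kmetric (p : klein) (u v : 'rV[R]_3) : R :=
  dot u v / (kradius ^+ 2 - dot p p) +
  (dot p u * dot p v) / (kradius ^+ 2 - dot p p) ^+ 2.

(* Geodesic rays are straight segments in this model, so this is the cosine
   of the hyperbolic angle at p between the rays from p to x and to y. *)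
Definition cos_angle (p x y : klein) : R :=
  kmetric p (kpt x - kpt p) (kpt y - kpt p) /
  (Num.sqrt (kmetric p (kpt x - kpt p) (kpt x - kpt p)) *
   Num.sqrt (kmetric p (kpt y - kpt p) (kpt y - kpt p))).

Definition chord (p v : 'rV[R]_3) : set klein :=
  [set x | exists t : R, kpt x = p + t *: v].

Definition hline (L : set klein) : Prop :=
  L !=set0 /\ exists p v, v != 0 /\ L = chord p v.

Record hisom := HIsom {
  hfun :> klein -> klein;
  hinv : klein -> klein;
  hfunK : cancel hfun hinv;
  hinvK : cancel hinv hfun;
  hisoP : forall x y, hdist (hfun x) (hfun y) = hdist x y }.

Lemma hisom_eq (g h : hisom) : g =1 h -> g = h.
Proof.
case: g h => [f f' fK f'K fP] [k k' kK k'K kP] /= /funext fk.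
case: _ / fk in k' kK k'K kP *.
have fk' : f' = k' by apply/funext => x; rewrite -[in LHS](k'K x) fK.
case: _ / fk' in kK k'K *.
by congr HIsom; exact: Prop_irrelevance.
Qed.

HB.instance Definition _ := gen_eqMixin hisom.
HB.instance Definition _ := gen_choiceMixin hisom.

Definition hisom1 : hisom :=
  @HIsom id id (fun=> erefl) (fun=> erefl) (fun _ _ => erefl).

Definition hisomM (g h : hisom) : hisom :=
  HIsom (can_comp (hfunK g) (hfunK h)) (can_comp (hinvK h) (hinvK g))
    (fun x y => etrans (hisoP g (h x) (h y)) (hisoP h x y)).

Lemma hinv_iso (g : hisom) x y : hdist (hinv g x) (hinv g y) = hdist x y.
Proof. by rewrite -(hisoP g) !hinvK. Qed.

Definition hisomV (g : hisom) : hisom :=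
  HIsom (hinvK g) (hfunK g) (hinv_iso g).

Fact hisomMA : associative hisomM.
Proof. by move=> f g h; exact: hisom_eq. Qed.

Fact hisom1M : left_id hisom1 hisomM.
Proof. by move=> g; exact: hisom_eq. Qed.

Fact hisomM1 : right_id hisom1 hisomM.
Proof. by move=> g; exact: hisom_eq. Qed.

Fact hisomVM : left_inverse hisom1 hisomV hisomM.
Proof. by move=> g; apply: hisom_eq => x /=; rewrite hfunK. Qed.

Fact hisomMV : right_inverse hisom1 hisomV hisomM.
Proof. by move=> g; apply: hisom_eq => x /=; rewrite hinvK. Qed.

HB.instance Definition _ :=
  isGroup.Build hisom hisomMA hisom1M hisomM1 hisomVM hisomMV.

Definition fixes (g : hisom) (L : set klein) : Prop :=
  forall x, L x -> g x = x.

(* Hyperbolic rotation about the line L by an angle theta in [0, pi], in either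
   sense: every ray issuing perpendicularly from a point p of L is turned by
   theta.  For theta = pi / 2 this forces g to preserve orientation, since a
   reflection in a plane through L fixes a ray perpendicular to L. *)
Definition rotation_by (theta : R) (L : set klein) (g : hisom) : Prop :=
  fixes g L /\
  forall p x, L p -> x != p ->
    (forall q, L q -> q != p -> cos_angle p q x = 0) ->
    cos_angle p x (g x) = cos theta.

Definition axis_a : set klein := chord (vec3 0 0 golden) (vec3 1 0 0).
Definition axis_b : set klein := chord (vec3 golden 0 0) (vec3 0 1 0).
Definition axis_c : set klein := chord (vec3 0 golden 0) (vec3 0 0 1).

Definition rotations (U : set hisom) : set hisom :=
  [set g | [/\ U g, g <> 1%g & exists2 L, hline L & fixes g L]].

End KleinModel.

Arguments axis_a R : clear implicits.
Arguments axis_b R : clear implicits.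
Arguments axis_c R : clear implicits.

Section Subgroups.
Variable T : groupType.
Implicit Types G U X : set T.

Definition subgroup G : Prop := group_closed (mem G).

Definition generated X : set T := smallest subgroup X.

Definition left_cosets U G : set (set T) :=
  [set [set (x * g)%g | g in G] | x in U].

Definition odd_index U G : Prop :=
  exists2 n, odd n & (left_cosets U G #= `I_n)%card.

End Subgroups.

(* Main.v *)
From mathcomp Require Import fingroup perm action cyclic pgroup sylow.
From mathcomp Require Import ring lra.
Require Import Defs.
From HB Require Import structures.
From mathcomp Require Import all_boot all_order all_algebra.
From mathcomp Require Import all_classical all_reals all_analysis.

Set Implicit Arguments.
Unset Strict Implicit.
Unset Printing Implicit Defensive.

Import Order.TTheory GRing.Theory Num.Theory.

Local Open Scope classical_set_scope.
Local Open Scope ring_scope.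

(** The hypothesis that the index is odd settles the theorem by a parity
    argument. An element [g] of [U] acts by left multiplication on the set of
    left cosets [U / G], which has odd cardinality. If the order of [g] is a
    power of 2, the orbits of this action have sizes powers of 2, so one of
    them is a singleton (lemma [perm_2power_fixpoint]). A coset fixed by [g],
    say [g * (x * G) = x * G], puts the conjugate [g ^ x] in [G] (lemma
    [odd_index_conj_mem]). Conjugating powers of [g] by the same [x] gives
    powers of [g ^ x], so [a], [b] and [c] are the only elements to consider.

    It remains to derive from the metric definition of a rotation by [pi / 2]
    that [a], [b] and [c] have fourth power 1. A point [x] of the ball of
    radius [r] is lifted to the hyperboloid as [(r, x) / height x], where
    distances are read off the Lorentz product. The vectors of an axis span a
    Lorentz plane [W], and its orthogonal [W'] is a Euclidean plane. An
    isometry that fixes the axis preserves the component of every lifted point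
    on [W], hence the norm of its component on [W']. The right angle at the
    foot of the perpendicular from [x] to the axis says that the components on
    [W'] of [x] and of its image are orthogonal (lemma
    [right_angle_rotation_sides]). Two orthogonal moves of constant norm in a
    plane end at the initial vector or at its opposite (lemma
    [right_turn_twice]), whatever the senses of the two turns. Thus the square
    of the rotation sends each point either to itself or to its image by the
    half-turn about the axis, and injectivity makes the fourth power trivial
    (lemma [right_angle_rotation_order4]). *)

(** * Actions of elements of 2-power order on an odd set of cosets *)

(** Modulo 2, a 2-group fixes as many points as there are in total. *)
Lemma perm_2power_fixpoint n k (s : 'S_n) :
  odd n -> (s ^+ (2 ^ k) = 1)%g -> exists i, s i = i.
Proof.
move=> nodd sk.
have p2 : (2%N.-group <[s]>)%g.
  apply: (@pnat_dvd _ (2 ^ k)%N); last by rewrite pnatX pnat_id.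
  by rewrite order_dvdn; apply/eqP.
have acts_s : ([acts <[s]>, on [set: 'I_n]%SET | 'P])%g.
  by apply/actsP => t _ i; rewrite !finset.inE.
have := pgroup_fix_mod p2 acts_s.
rewrite cardsT card_ord !modn2 nodd => oddfix.
have /card_gt0P[i] : (0 < #|('Fix_([set: 'I_n]%SET | 'P)(<[s]>))%g|)%N.
  by move: oddfix; case: (#|_|).
rewrite finset.inE => /andP[_ /afixP/(_ s (cycle_id s)) si].
by exists i.
Qed.

Section CosetAction.
Variable T : groupType.
Implicit Types (G U X A : set T) (g x y : T).

Lemma subgroup_generated X : subgroup (generated X).
Proof.
split=> [|x y]; first by rewrite inE => A [[A1 _] _]; rewrite inE in A1.
rewrite !inE => Xx Xy A [sA XA].
have [_ /(_ x y)] := sA; rewrite !inE; apply.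
- exact: Xx.
- exact: Xy.
Qed.

Lemma subgroupM G x y : subgroup G -> G x -> G y -> G (x * y)%g.
Proof. by move=> /group_closedM/(_ x y); rewrite !inE; apply. Qed.

Lemma subgroupX G x n : subgroup G -> G x -> G (x ^+ n)%g.
Proof.
move=> sG Gx; elim: n => [|n IHn]; first by case: sG; rewrite inE.
by rewrite expgS; exact: subgroupM.
Qed.

Definition translate g A : set T := [set (g * y)%g | y in A].

Lemma translateM g h A : translate (g * h)%g A = translate g (translate h A).
Proof.
apply/seteqP; split=> [_ [y Ay <-]|_ [_ [y Ay <-] <-]].
  by exists (h * y)%g; [exists y | rewrite mulgA].
by exists y; rewrite ?mulgA.
Qed.

Lemma translate1 A : translate 1%g A = A.
Proof.
apply/seteqP; split=> [_ [y Ay <-]|y Ay]; first by rewrite mul1g.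
by exists y; rewrite ?mul1g.
Qed.

Lemma translate_inj g : injective (translate g).
Proof.
by apply: (@can_inj _ _ _ (translate g^-1%g)) => A;
   rewrite -translateM mulVg translate1.
Qed.

Lemma left_cosets_translate U G g A :
  subgroup U -> U g -> left_cosets U G A -> left_cosets U G (translate g A).
Proof.
move=> sU Ug [x Ux <-]; exists (g * x)%g; first exact: subgroupM.
exact: translateM.
Qed.

(** Numbering the cosets turns left multiplication by [g] into a permutation of
    ['I_n]; if it fixes the coset [x * G], then [g * x] lies in [x * G]. *)
Lemma odd_index_conj_mem U G g k :
    subgroup U -> subgroup G -> odd_index U G -> U g -> (g ^+ (2 ^ k) = 1)%g ->
  exists2 u, U u & G (g ^ u)%g.
Proof.
move=> sU sG [n nodd /card_set_bijP[f [fI finj fsurj]]] Ug gk.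
have /choice[h hP] (i : 'I_n) :
    exists A, left_cosets U G A /\ f A = i.
  by have [A UA fA] := fsurj i (ltn_ord i); exists A.
have gh i : left_cosets U G (translate g (h i)).
  by apply: left_cosets_translate => //; case: (hP i).
pose s0 i : 'I_n := Ordinal (fI _ (gh i)).
have hs0 i : h (s0 i) = translate g (h i).
  have [? fhs] := hP (s0 i); apply: finj; rewrite ?inE //.
have s0inj : injective s0.
  move=> i j sij; have : translate g (h i) = translate g (h j).
    by rewrite -!hs0 sij.
  move/translate_inj => hij; apply: val_inj.
  by rewrite /= -(hP i).2 -(hP j).2 hij.
pose s : 'S_n := perm s0inj.
have hsX m i : h ((s ^+ m)%g i) = translate (g ^+ m)%g (h i).
  elim: m i => [|m IHm] i; first by rewrite !expg0 perm1 translate1.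
  by rewrite expgSr permM permE hs0 IHm -translateM -expgS.
have sk : (s ^+ (2 ^ k) = 1)%g.
  apply/perm.permP => i; apply: ord_inj; rewrite perm1 -(hP i).2 -(hP _).2.
  by rewrite hsX gk translate1.
have [i /= si] := perm_2power_fixpoint nodd sk.
have [[x Ux hx] _] := hP i.
have gxi : translate g (h i) = h i by rewrite -hs0 -[in RHS]si permE.
have : h i (g * x)%g.
  rewrite -gxi; exists x => //; rewrite -hx; exists 1%g; rewrite ?mulg1 //.
  by case: sG; rewrite inE.
rewrite -hx => -[y Gy xy]; exists x => //.
by rewrite conjgE -xy mulKg.
Qed.

End CosetAction.

(** * Two right turns in a weighted Euclidean plane *)

(** In dimension 2 the orthogonal of a nonzero vector is a line: [x] and [z] are
    both orthogonal to [y], hence proportional, and their norms agree. *)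
Lemma right_turn_twice (R : realFieldType) (w x1 x2 y1 y2 z1 z2 : R) : 0 < w ->
    x1 * y1 + w * x2 * y2 = 0 -> y1 * z1 + w * y2 * z2 = 0 ->
    y1 ^+ 2 + w * y2 ^+ 2 = x1 ^+ 2 + w * x2 ^+ 2 ->
    z1 ^+ 2 + w * z2 ^+ 2 = y1 ^+ 2 + w * y2 ^+ 2 ->
  (z1 = x1 /\ z2 = x2) \/ (z1 = - x1 /\ z2 = - x2).
Proof.
move=> w0 xy yz nyx nzy.
have def0 (u v : R) : u ^+ 2 + w * v ^+ 2 = 0 -> u = 0 /\ v = 0.
  move/eqP; rewrite paddr_eq0 ?sqr_ge0 ?(mulr_ge0 (ltW w0)) ?sqr_ge0 //.
  rewrite (mulf_eq0 w) (gt_eqF w0) /=.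
  by rewrite !sqrf_eq0 => /andP[/eqP-> /eqP->].
have nzx := etrans nzy nyx; set q := x1 ^+ 2 + w * x2 ^+ 2 in nyx nzx.
have [q0|q_neq0] := eqVneq q 0.
  have [-> ->] := def0 _ _ q0; rewrite q0 in nzx.
  by have [-> ->] := def0 _ _ nzx; left.
have det0 : x1 * z2 - x2 * z1 = 0.
  apply: (mulIf q_neq0); rewrite mul0r -nyx.
  transitivity
    (y1 * (z2 * (x1 * y1 + w * x2 * y2) - x2 * (y1 * z1 + w * y2 * z2))
    + y2 * (x1 * (y1 * z1 + w * y2 * z2) - z1 * (x1 * y1 + w * x2 * y2))).
    by ring.
  by rewrite xy yz; ring.
(* Lagrange's identity: the square of the inner product of [x] and [z], plus
   [w] times the square of their determinant, is the product of their norms. *)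
have dotq : (x1 * z1 + w * x2 * z2 - q) * (x1 * z1 + w * x2 * z2 + q) = 0.
  have -> : (x1 * z1 + w * x2 * z2 - q) * (x1 * z1 + w * x2 * z2 + q) =
    q * (z1 ^+ 2 + w * z2 ^+ 2) - w * (x1 * z2 - x2 * z1) ^+ 2 - q ^+ 2.
    by rewrite /q; ring.
  by rewrite det0 nzx; ring.
move/eqP: dotq; rewrite mulf_eq0 => /orP[]/eqP dq; [left|right].
  have [/eqP + /eqP] : z1 - x1 = 0 /\ z2 - x2 = 0.
    apply: def0; transitivity ((z1 ^+ 2 + w * z2 ^+ 2 - q) -
      (x1 * z1 + w * x2 * z2 - q) *+ 2); first by rewrite /q; ring.
    by rewrite nzx dq; ring.
  by rewrite !subr_eq0 => /eqP-> /eqP->.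
have [/eqP + /eqP] : z1 + x1 = 0 /\ z2 + x2 = 0.
  apply: def0; transitivity ((z1 ^+ 2 + w * z2 ^+ 2 - q) +
    (x1 * z1 + w * x2 * z2 + q) *+ 2); first by rewrite /q; ring.
  by rewrite nzx dq; ring.
by rewrite !addr_eq0 => /eqP-> /eqP->.
Qed.

(** * The lift of the Klein model to the hyperboloid *)

Section KleinGeometry.
Variable R : realType.
Implicit Types (x y p q : klein R) (u v : 'rV[R]_3) (g : hisom R).

Local Notation r2 := (kradius R ^+ 2).

Lemma dot_ge0 u : 0 <= dot u u.
Proof. by apply: sumr_ge0 => i _; rewrite -expr2 sqr_ge0. Qed.

Lemma dotuu_eq0 u : dot u u = 0 -> u = 0.
Proof.
move=> /eqP; rewrite psumr_eq0; last by move=> i _; rewrite -expr2 sqr_ge0.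
move=> /allP u0; apply/rowP => i; rewrite mxE; apply/eqP.
by have /= := u0 i (mem_index_enum i); rewrite -expr2 sqrf_eq0.
Qed.

Lemma dotBB u v : dot (u - v) (u - v) = dot u u + dot v v - dot u v *+ 2.
Proof.
rewrite /dot -sumrMnl -big_split -sumrB; apply: eq_bigr => i _ /=.
by rewrite !mxE; ring.
Qed.

(** The number [u + Num.sqrt (u ^+ 2 - 1)] and its inverse have sum [2 u], so
    [u] is recovered as the hyperbolic cosine of [acosh u]. *)
Lemma acosh_inj : {in [pred u | 1 <= u] &, injective (@acosh R)}.
Proof.
have key (u : R) : 1 <= u ->
    u = (expR (acosh u) + (expR (acosh u))^-1) / 2.
  move=> u1; have s0 : 0 <= u ^+ 2 - 1 by nra.
  have e0 : 0 < u + Num.sqrt (u ^+ 2 - 1).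
    by rewrite ltr_wpDr ?sqrtr_ge0 //; lra.
  rewrite /acosh lnK ?posrE //.
  have <- : u - Num.sqrt (u ^+ 2 - 1) = (u + Num.sqrt (u ^+ 2 - 1))^-1.
    apply: (mulfI (lt0r_neq0 e0)); rewrite mulfV ?lt0r_neq0 //.
    have := sqr_sqrtr s0; set t := Num.sqrt _ => t2.
    by transitivity (u ^+ 2 - t ^+ 2); [ring | rewrite t2; ring].
  by field.
move=> u v; rewrite !inE => u1 v1 uv.
by rewrite (key u u1) (key v v1) uv.
Qed.

Definition cosh_dist x y : R :=
  (r2 - dot x y) / Num.sqrt ((r2 - dot x x) * (r2 - dot y y)).

Lemma r2B_gt0 x : 0 < r2 - dot x x.
Proof. by rewrite subr_gt0 kptP. Qed.

(** The reversed Cauchy-Schwarz inequality for timelike vectors. *)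
Lemma cosh_dist_ge1 x y : 1 <= cosh_dist x y.
Proof.
have Nx := r2B_gt0 x; have Ny := r2B_gt0 y.
have dd := dot_ge0 (kpt x - kpt y); rewrite dotBB in dd.
have xy0 : 0 < r2 - dot x y by lra.
rewrite ler_pdivlMr ?sqrtr_gt0 ?mulr_gt0 // mul1r -(ger0_norm (ltW xy0)).
rewrite -sqrtr_sqr; apply: ler_wsqrtr; rewrite -subr_ge0.
have -> : (r2 - dot x y) ^+ 2 - (r2 - dot x x) * (r2 - dot y y) =
   (r2 - dot x x) * (dot x x + dot y y - dot x y *+ 2) +
   (dot x y - dot x x) ^+ 2.
  by ring.
by rewrite addr_ge0 ?sqr_ge0 // mulr_ge0 // ltW.
Qed.

Lemma cosh_dist_iso g x y : cosh_dist (g x) (g y) = cosh_dist x y.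
Proof. by apply: acosh_inj (hisoP g x y); rewrite inE cosh_dist_ge1. Qed.

(** The Lorentz length of [(kradius R, x)], so that the lift of [x] to the
    hyperboloid is [(kradius R, x) / height x]. *)
Definition height x : R := Num.sqrt (r2 - dot x x).

Lemma height_gt0 x : 0 < height x.
Proof. by rewrite sqrtr_gt0 r2B_gt0. Qed.

Lemma height_sq x : height x ^+ 2 = r2 - dot x x.
Proof. by rewrite sqr_sqrtr // ltW ?r2B_gt0. Qed.

(** Dividing by the height of [q] only, the Lorentz product with a fixed vector
    is an invariant of [g] that is linear in the lift of [x]. *)
Lemma fixed_point_pairing g x q : g q = q ->
  (r2 - dot (g x) q) / height (g x) = (r2 - dot x q) / height x.
Proof.
move=> gq; have := cosh_dist_iso g x q; rewrite gq /cosh_dist.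
rewrite !sqrtrM ?ltW ?r2B_gt0 // -!/(height _) !invfM !mulrA.
by move/(mulIf _); apply; rewrite invr_neq0 // lt0r_neq0 ?height_gt0.
Qed.

Lemma kmetric_gt0 p u : u != 0 -> 0 < kmetric p u u.
Proof.
move=> u0; rewrite /kmetric -expr2 ltr_wpDr //.
  by rewrite divr_ge0 ?sqr_ge0.
rewrite divr_gt0 ?r2B_gt0 // lt0r dot_ge0 andbT.
by apply: contra_neq u0; exact: dotuu_eq0.
Qed.

Lemma cos_angle_eq0 p x y : x != p -> y != p ->
  (cos_angle p x y = 0) <-> (kmetric p (kpt x - kpt p) (kpt y - kpt p) = 0).
Proof.
have knz z : z != p -> 0 < kmetric p (kpt z - kpt p) (kpt z - kpt p).
  move=> zp; apply: kmetric_gt0; rewrite subr_eq0.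
  by apply: contra_neq zp; exact: val_inj.
move=> xp yp; rewrite /cos_angle; split=> [/eqP|->]; last by rewrite mul0r.
rewrite mulf_eq0 invr_eq0 mulf_eq0 !sqrtr_eq0 !leNgt !knz //= !orbF.
by move/eqP.
Qed.

(** * Isometries fixing a line parallel to a coordinate axis *)

Section CoordinateAxis.
Variables (i j k : 'I_3) (s : R).
Hypotheses (ijk : uniq [:: i; j; k]) (s_r2 : s ^+ 2 < r2).

Local Notation e_ := (delta_mx 0).
Local Notation axis := (@chord R (s *: e_ k) (e_ i)).
Local Notation S := (r2 - s ^+ 2).
Local Notation C := (r2 / S).

Let S_gt0 : 0 < S. Proof. by rewrite subr_gt0. Qed.

Let C_gt0 : 0 < C.
Proof. by rewrite divr_gt0 // (le_lt_trans (sqr_ge0 s)). Qed.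

Let neq_ijk : [/\ i != j, i != k & j != k].
Proof. by move: ijk; rewrite /= !inE negb_or andbT => /andP[/andP[]]. Qed.

Let ij : (i == j) = false. Proof. by apply/negbTE; case: neq_ijk. Qed.
Let ik : (i == k) = false. Proof. by apply/negbTE; case: neq_ijk. Qed.
Let jk : (j == k) = false. Proof. by apply/negbTE; case: neq_ijk. Qed.
Let ji : (j == i) = false. Proof. by rewrite eq_sym ij. Qed.
Let ki : (k == i) = false. Proof. by rewrite eq_sym ik. Qed.

Let all_ijk (l : 'I_3) : l \in [:: i; j; k].
Proof.
have sub : {subset [:: i; j; k] <= enum 'I_3} by move=> ? _; rewrite mem_enum.
have [|_ ->] := uniq_min_size ijk sub; first by rewrite size_enum_ord.
by rewrite mem_enum.
Qed.

Let dotE u v : dot u v = u 0 i * v 0 i + u 0 j * v 0 j + u 0 k * v 0 k.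
Proof.
rewrite -addrA; have <- : \sum_(l <- [:: i; j; k]) u 0 l * v 0 l = dot u v.
  by rewrite big_uniq //=; apply: eq_bigl => l; rewrite all_ijk.
by rewrite unlock /= addr0.
Qed.

(** Coordinates of the lift [X] of [x] in a Lorentz orthogonal basis. The
    vectors [(kradius R, s e_k)] and [(0, e_i)] span the plane [W] of the axis,
    and up to constant factors [depth] and [along] are the products of [X] with
    them. Likewise [side1] and [side2] belong to [(0, e_j)] and
    [(s, kradius R e_k)], which span the orthogonal of [W]; on this Euclidean
    plane the squared norm is [side1 ^+ 2 + C * side2 ^+ 2]. *)
Definition along x : R := x 0 i / height x.
Definition depth x : R := (r2 - s * x 0 k) / height x.
Definition side1 x : R := x 0 j / height x.
Definition side2 x : R := (x 0 k - s) / height x.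

(** The lift has Lorentz norm -1. *)
Lemma hyperboloid x :
  depth x ^+ 2 / S = 1 + along x ^+ 2 + (side1 x ^+ 2 + C * side2 x ^+ 2).
Proof.
have h0 := height_gt0 x; have := height_sq x; rewrite dotE => h2.
apply: (mulIf (lt0r_neq0 (exprn_gt0 2 h0))).
rewrite /depth /along /side1 /side2.
have -> : ((r2 - s * x 0 k) / height x) ^+ 2 / S * height x ^+ 2
   = (r2 - s * x 0 k) ^+ 2 / S.
  by field; rewrite !lt0r_neq0.
have -> : (1 + (x 0 i / height x) ^+ 2 +
   ((x 0 j / height x) ^+ 2 + C * ((x 0 k - s) / height x) ^+ 2)) *
  height x ^+ 2 =
  height x ^+ 2 + x 0 i ^+ 2 + x 0 j ^+ 2 + C * (x 0 k - s) ^+ 2.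
  by field; rewrite !lt0r_neq0.
by rewrite h2; field; rewrite !lt0r_neq0.
Qed.

(** The first Lorentz coordinate, hence the height, is a combination of [depth]
    and [side2]. *)
Lemma coordinates_inj x y :
    depth x = depth y -> along x = along y ->
    side1 x = side1 y -> side2 x = side2 y -> x = y.
Proof.
move=> dxy axy s1 s2; have hx := height_gt0 x; have hy := height_gt0 y.
have hE z : (height z)^-1 = (depth z + s * side2 z) / S.
  by rewrite /depth /side2; field; rewrite !lt0r_neq0 ?height_gt0.
have hxy : height x = height y by apply: invr_inj; rewrite !hE dxy s2.
have cancel_h (a b : R) : a / height x = b / height y -> a = b.
  by rewrite hxy; apply: mulIf; rewrite invr_neq0 // lt0r_neq0.
apply: val_inj; apply/rowP => l /=; move: (all_ijk l); rewrite !inE.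
case/or3P=> /eqP->; [exact: cancel_h|exact: cancel_h|].
by apply: (@addIr _ (- s)); exact: cancel_h.
Qed.

Lemma axis_point (t : R) : t ^+ 2 < S ->
  exists2 q : klein R, axis q & kpt q = s *: e_ k + t *: e_ i.
Proof.
move=> tS.
have qP : dot (s *: e_ k + t *: e_ i) (s *: e_ k + t *: e_ i) < r2.
  by rewrite dotE !mxE !eqxx jk ji ki ik /=; lra.
by exists (Klein qP) => //; exists t.
Qed.

Lemma axisP x : axis x <-> side1 x = 0 /\ side2 x = 0.
Proof.
have h0 := lt0r_neq0 (height_gt0 x); split.
  case=> t xt; rewrite /side1 /side2 xt !mxE !eqxx jk ji ki /=.
  by split; ring.
rewrite /side1 /side2; case=> /eqP + /eqP.
rewrite !mulf_eq0 invr_eq0 (negPf h0) !orbF subr_eq0 => /eqP xj /eqP xk.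
exists (x 0 i); apply/rowP => l; rewrite !mxE eqxx.
move: (all_ijk l); rewrite !inE; case/or3P=> /eqP->.
- by rewrite eqxx ik /=; ring.
- by rewrite xj jk ji /=; ring.
- by rewrite xk eqxx ki /=; ring.
Qed.

Lemma axis_coords q : axis q -> q 0 j = 0 /\ q 0 k = s.
Proof. by case=> t ->; rewrite !mxE !eqxx jk ji ki /=; split; ring. Qed.

Lemma depth_gt0 x : 0 < depth x.
Proof.
rewrite divr_gt0 ?height_gt0 //; have := r2B_gt0 x; rewrite dotE => x_r2.
have := sqr_ge0 (x 0 k - s); have := sqr_ge0 (x 0 i); have := sqr_ge0 (x 0 j).
have := S_gt0; lra.
Qed.

Lemma fixes_depth g x : fixes g axis -> depth (g x) = depth x.
Proof.
move=> fg; have [|q aq qE] := @axis_point 0; first by rewrite expr0n.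
have := fixed_point_pairing x (fg _ aq).
suff dq y : dot y q = s * y 0 k by rewrite !dq.
by rewrite dotE qE !mxE !eqxx jk ji ki ik /=; ring.
Qed.

(** A fixed point of the axis other than the one nearest to the origin gives a
    second invariant; the value of [t] below keeps that point in the ball. *)
Lemma fixes_along g x : fixes g axis -> along (g x) = along x.
Proof.
move=> fg; pose t := Num.sqrt S / 2.
have t2 : t ^+ 2 = S / 4 by rewrite expr_div_n sqr_sqrtr ?ltW //; field.
have t0 : t != 0 by rewrite mulf_neq0 ?lt0r_neq0 ?sqrtr_gt0.
have [|q aq qE] := @axis_point t; first by rewrite t2; have := S_gt0; lra.
have := fixed_point_pairing x (fg _ aq).
have dq y : (r2 - dot y q) / height y = depth y - t * along y.
  by rewrite /depth /along dotE qE !mxE !eqxx jk ji ki ik /=; ring.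
rewrite !dq fixes_depth // => /addrI/oppr_inj.
exact: mulfI.
Qed.

Lemma fixes_side_norm g x : fixes g axis ->
  side1 (g x) ^+ 2 + C * side2 (g x) ^+ 2 = side1 x ^+ 2 + C * side2 x ^+ 2.
Proof.
move=> fg; have := hyperboloid (g x).
rewrite fixes_depth // fixes_along // hyperboloid.
by move/addrI.
Qed.

(** The Lorentz projection of the lift of [x] on [W] points to [p], the foot of
    the perpendicular from [x]. It depends only on the coordinates on [W], so
    that [x] and its image by an isometry fixing the axis have the same foot. *)
Definition is_foot p x : Prop := axis p /\ p 0 i * depth x = S * along x.

(** The projection on [W] is timelike, its orthogonal being spacelike; hence it
    meets the ball. *)
Lemma foot_exists x : exists p, is_foot p x.
Proof.
have d0 := depth_gt0 x.
have [|p ap pE] := @axis_point (S * along x / depth x).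
  have := hyperboloid x; have := mulr_ge0 (ltW C_gt0) (sqr_ge0 (side2 x)).
  have := sqr_ge0 (side1 x) => s1 s2 hyp.
  have : along x ^+ 2 < depth x ^+ 2 / S by rewrite hyp; lra.
  rewrite ltr_pdivlMr // => hd.
  rewrite expr_div_n ltr_pdivrMr ?exprn_gt0 // exprMn expr2 -mulrA ltr_pM2l //.
  by rewrite mulrC.
exists p; split=> //; rewrite pE !mxE !eqxx ik /=.
by rewrite mulr0 add0r mulr1 mulfVK // lt0r_neq0.
Qed.

Let foot_coordE p x : is_foot p x -> x 0 i = p 0 i * (r2 - s * x 0 k) / S.
Proof.
have h0 := lt0r_neq0 (height_gt0 x).
case=> _; rewrite /depth /along !mulrA => /(mulIf _) -> //; last first.
  by rewrite invr_neq0.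
by rewrite mulrC mulKf // lt0r_neq0.
Qed.

Let r2B_axis p : axis p -> r2 - dot p p = S - p 0 i ^+ 2.
Proof. by move=> /axis_coords[pj pk]; rewrite dotE pj pk; ring. Qed.

Lemma foot_perpendicular p q x : is_foot p x -> axis q ->
  kmetric p (kpt q - kpt p) (kpt x - kpt p) = 0.
Proof.
move=> px aq; have [ap _] := px.
have [pj pk] := axis_coords ap; have [qj qk] := axis_coords aq.
have p0 := r2B_gt0 p; rewrite r2B_axis // in p0.
rewrite /kmetric r2B_axis // !dotE !mxE (foot_coordE px) pj pk qj qk.
by field; rewrite !lt0r_neq0.
Qed.

(** The tangent vectors at [p] towards [x] and [y] are orthogonal to the axis,
    so they are positive multiples of the components of the lifts on the
    orthogonal of [W]. *)
Lemma kmetric_foot p x y : is_foot p x -> is_foot p y ->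
  kmetric p (kpt x - kpt p) (kpt y - kpt p) =
  height x * height y / (r2 - dot p p) *
    (side1 x * side1 y + C * side2 x * side2 y).
Proof.
move=> px py; have [ap _] := px.
have [pj pk] := axis_coords ap.
have p0 := r2B_gt0 p; rewrite r2B_axis // in p0.
have hx := height_gt0 x; have hy := height_gt0 y.
rewrite /kmetric r2B_axis // !dotE !mxE (foot_coordE px) (foot_coordE py) pj pk.
by rewrite /side1 /side2; field; rewrite !lt0r_neq0.
Qed.

(** The defining right angle, taken at the common foot of [x] and [g x]; on the
    axis both side coordinates vanish. *)
Lemma right_angle_rotation_sides g x : rotation_by (pi / 2) axis g ->
  side1 x * side1 (g x) + C * side2 x * side2 (g x) = 0.
Proof.
case=> fg rg; have [ax|nax] := pselect (axis x).
  by have [-> ->] := (axisP x).1 ax; ring.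
have [p px] := foot_exists x; have [ap _] := px.
have pgx : is_foot p (g x).
  by split=> //; rewrite fixes_depth // fixes_along //; case: px.
have xp : x != p by apply/eqP => xp; apply: nax; rewrite xp.
have gxp : g x != p.
  by apply: contra_neq xp => gxp; apply: (can_inj (hfunK g)); rewrite gxp fg.
have perp q : axis q -> q != p -> cos_angle p q x = 0.
  by move=> aq qp; apply/cos_angle_eq0 => //; exact: foot_perpendicular.
have := rg p x ap xp perp; rewrite cos_pihalf => /cos_angle_eq0-/(_ xp gxp).
rewrite kmetric_foot // => /eqP; rewrite mulf_eq0 gt_eqF ?orFb.
  by move/eqP.
by rewrite divr_gt0 ?r2B_gt0 // mulr_gt0 ?height_gt0.
Qed.

(** The sense of rotation could a priori depend on the point, so the square is
    only known pointwise to be the identity or the half-turn. If it is the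
    half-turn at [x] and the identity at the image, injectivity of [g] gives
    [g (g x) = x]. *)
Lemma right_angle_rotation_order4 g :
  rotation_by (pi / 2) axis g -> (g ^+ 4 = 1)%g.
Proof.
move=> rg; have fg := rg.1.
have twice x : g (g x) = x \/ [/\ depth (g (g x)) = depth x,
    along (g (g x)) = along x, side1 (g (g x)) = - side1 x &
    side2 (g (g x)) = - side2 x].
  have d2 : depth (g (g x)) = depth x by rewrite !fixes_depth.
  have a2 : along (g (g x)) = along x by rewrite !fixes_along.
  have [[]|[]] := right_turn_twice C_gt0 (right_angle_rotation_sides x rg)
    (right_angle_rotation_sides (g x) rg) (fixes_side_norm x fg)
    (fixes_side_norm (g x) fg) => s1 s2; [left|by right].
  exact: coordinates_inj.
apply: hisom_eq => x; change (g (g (g (g x))) = x).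
have [g2|[d2 a2 s1 s2]] := twice x; first by rewrite g2 g2.
have [g4|[d4 a4 t1 t2]] := twice (g (g x)).
  by rewrite g4; do 2!apply: (can_inj (hfunK g)).
apply: coordinates_inj; first by rewrite d4.
- by rewrite a4.
- by rewrite t1 s1 opprK.
- by rewrite t2 s2 opprK.
Qed.

End CoordinateAxis.

(** * The three axes *)

Lemma golden_gt1 : 1 < golden R.
Proof.
have : Num.sqrt 1 < Num.sqrt (5 : R) by rewrite ltr_sqrt; lra.
by rewrite sqrtr1 /golden; lra.
Qed.

(** The square of the radius is [golden R ^+ 3], and [golden R > 1]. *)
Lemma golden_in_ball : golden R ^+ 2 < r2.
Proof.
have t1 := golden_gt1; have t0 : 0 < golden R by lra.
have -> : kradius R = golden R * Num.sqrt (golden R).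
  rewrite /kradius (_ : 3 / 2 = 1 + 2^-1); last by field.
  by rewrite powRD ?lt0r_neq0 ?implybT // powRr1 ?ltW // powR12_sqrt // ltW.
by rewrite [ltRHS]exprMn sqr_sqrtr ?ltW // ltr_pMr ?exprn_gt0.
Qed.

End KleinGeometry.

Theorem theorem8 (R : realType) (a b c : hisom R)
    (ha : rotation_by (pi / 2) (axis_a R) a)
    (hb : rotation_by (pi / 2) (axis_b R) b)
    (hc : rotation_by (pi / 2) (axis_c R) c)
    (U : set (hisom R)) (hU : U = generated [set a; b; c])
    (G : set (hisom R)) (hG : subgroup G) (hGU : G `<=` U)
    (hodd : odd_index U G)
    (hrot : G = generated (G `&` rotations U)) :
  forall g : hisom R,
    g \in [:: a; a ^+ 2; a ^+ 3; b; b ^+ 2; b ^+ 3; c; c ^+ 2; c ^+ 3]%g ->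
    exists2 u, U u & G (g ^ u)%g.
Proof.
have sU : subgroup U by rewrite hU; exact: subgroup_generated.
have [Ua Ub Uc] : [/\ U a, U b & U c].
  by rewrite hU; split; apply: sub_gen_smallest; [left; left|left; right|right].
(* The three axes are chords of the form treated above, for the three cyclic
   orders of the coordinates. *)
have delta (l : 'I_3) (t : R) : t *: delta_mx 0 l =
    vec3 (t *+ (l == 0%N :> nat)) (t *+ (l == 1%N :> nat))
         (t *+ (l == 2%N :> nat)).
  apply/rowP => m; rewrite !mxE eqxx /= -mulr_natr.
  by case: m l => [[|[|[|m]]] //= hm] [[|[|[|l]]] //= hl];
     rewrite ?mulr1 ?mulr0.
have delta1 (l : 'I_3) := etrans (esym (scale1r _)) (delta l 1).
have order4 i j k g : uniq [:: i; j; k] ->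
    rotation_by (pi / 2) (chord (golden R *: delta_mx 0 k) (delta_mx 0 i)) g ->
    (g ^+ (2 ^ 2) = 1)%g.
  move=> ijk; exact: (right_angle_rotation_order4 ijk (golden_in_ball R)).
have a4 : (a ^+ (2 ^ 2) = 1)%g.
  by apply: (@order4 0 1 2) => //; rewrite delta delta1.
have b4 : (b ^+ (2 ^ 2) = 1)%g.
  by apply: (@order4 1 2 0) => //; rewrite delta delta1.
have c4 : (c ^+ (2 ^ 2) = 1)%g.
  by apply: (@order4 2 0 1) => //; rewrite delta delta1.
have powers g n : U g -> (g ^+ (2 ^ 2) = 1)%g ->
    exists2 u, U u & G ((g ^+ n) ^ u)%g.
  move=> Ug g4; have [u Uu Gu] := odd_index_conj_mem sU hG hodd Ug g4.
  by exists u; rewrite // conjXg; exact: subgroupX.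
move=> g; rewrite !inE => /or4P[|||/or4P[|||/or3P[]]] /eqP->;
  [exact: (powers a 1%N) | exact: powers | exact: powers
  |exact: (powers b 1%N) | exact: powers | exact: powers
  |exact: (powers c 1%N) | exact: powers | exact: powers].
Qed.
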